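(* Let $d\ge 0$ be an integer and let $S(2,d)$ be the Schur algebra over $\mathbb{Q}$ (defined in the context). Then $S(2,d)$ is isomorphic with the associative $\mathbb{Q}$-algebra with $1$ generated by $e,f,h$ subject to the relations $$he-eh=2e,\qquad ef-fe=h,\qquad hf-fh=-2f,$$ $$(h+d)(h+d-2)\cdots(h-d+2)(h-d)=0.$$ Moreover, this presented algebra has a $\mathbb{Q}$-basis consisting of all $f^a h^b e^c$ with $a,b,c$ nonnegative integers such that $a+b+c\le d$.
   Context: Let $E$ be a $2$-dimensional $\mathbb{Q}$-vector space with fixed basis $e_1,e_2$, identifying $GL(E)$ with $GL_2(\mathbb{Q})$. The group $GL_2(\mathbb{Q})$ acts diagonally on the tensor power $E^{\otimes d}$; extending linearly gives a representation of the group algebra $\mathbb{Q}GL_2(\mathbb{Q})\to \mathrm{End}(E^{\otimes d})$, and the Schur algebra $S(2,d)$ is its image. Equivalently, $S(2,d)$ is the image of the representation $\rho_d:U(\mathfrak{gl}_2)\to\mathrm{End}(E^{\otimes d})$ of the universal enveloping algebra obtained by differentiating (an element $x\in\mathfrak{gl}_2$ acts as $\sum_{i=1}^d 1\otimes\cdots\otimes x\otimes\cdots\otimes 1$, with $x$ in the $i$-th slot). *)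

(* Defs.v *)
From HB Require Import structures.
From mathcomp Require Import all_boot all_order all_algebra.
Set Implicit Arguments. Unset Strict Implicit. Unset Printing Implicit Defensive.
Import Order.TTheory GRing.Theory Num.Theory.
Local Open Scope ring_scope.

(* Basis of E^{\otimes d}: e_{w 0} \otimes ... \otimes e_{w (d-1)}, for w : 'I_d -> 'I_2
   ('I_2 = {0,1} stands for the basis {e_1,e_2} of E).  Endomorphisms of
   E^{\otimes d} are (N d) x (N d) rational matrices, acting on column vectors,
   rows/columns indexed by the enumeration of these basis words. *)
Definition tword (d : nat) := {ffun 'I_d -> 'I_2}.
Definition N (d : nat) : nat := #|{: tword d}|.
Definition word_of (d : nat) (i : 'I_(N d)) : tword d := enum_val i.

(* rho_d(x) = sum_k 1 \otimes ... \otimes x (k-th slot) \otimes ... \otimes 1,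
   for x in gl_2 = 'M[rat]_2 (acting on column vectors w.r.t. e_1, e_2). *)
Definition rho (d : nat) (x : 'M[rat]_2) : 'M[rat]_(N d) :=
  \matrix_(i, j) \sum_(k < d)
     (if [forall l : 'I_d, (l != k) ==> (word_of i l == word_of j l)]
      then x (word_of i k) (word_of j k) else 0).

Definition mxprod (n : nat) (s : seq 'M[rat]_n) : 'M[rat]_n := foldr mulmx 1%:M s.
Definition mxpow (n : nat) (A : 'M[rat]_n) (k : nat) : 'M[rat]_n := iter k (mulmx A) 1%:M.

(* The Schur algebra S(2,d) = rho_d(U(gl_2)): since U(gl_2) is spanned by the
   monomials x_1 ... x_k (x_i in gl_2, k >= 0), its image is the Q-span of the
   products rho_d(x_1) ... rho_d(x_k). *)
Definition in_schur (d : nat) (A : 'M[rat]_(N d)) : Prop :=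
  exists s : seq (rat * seq 'M[rat]_2),
    A = \sum_(p <- s) p.1 *: mxprod [seq rho d x | x <- p.2].

Definition Emx (d : nat) : 'M[rat]_(N d) := rho d (delta_mx 0 1).
Definition Fmx (d : nat) : 'M[rat]_(N d) := rho d (delta_mx 1 0).
Definition Hmx (d : nat) : 'M[rat]_(N d) := rho d (delta_mx 0 0 - delta_mx 1 1).

Definition sl2d_rels (d : nat) (B : algType rat) (e f h : B) : Prop :=
  [/\ h * e - e * h = e *+ 2,
      e * f - f * e = h,
      h * f - f * h = - (f *+ 2)
    & \prod_(i < d.+1) (h + ((d%:Z - (2 * i)%:Z)%:~R : rat)%:A) = 0].

Definition sl2d_rels_mx (d : nat) (n : nat) (e f h : 'M[rat]_n) : Prop :=
  [/\ h *m e - e *m h = e *+ 2,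
      e *m f - f *m e = h,
      h *m f - f *m h = - (f *+ 2)
    & mxprod [seq h + ((d%:Z - (2 * i)%:Z)%:~R : rat)%:M | i <- iota 0 d.+1] = 0].

Definition gen3 (n : nat) (e f h : 'M[rat]_n) (i : 'I_3) : 'M[rat]_n :=
  if val i == 0%N then e else if val i == 1%N then f else h.
Definition in_span_words (n : nat) (e f h : 'M[rat]_n) (A : 'M[rat]_n) : Prop :=
  exists s : seq (rat * seq 'I_3),
    A = \sum_(p <- s) p.1 *: mxprod [seq gen3 e f h i | i <- p.2].

Definition pbw (d : nat) (t : 'I_d.+1 * 'I_d.+1 * 'I_d.+1) : 'M[rat]_(N d) :=
  mxpow (Fmx d) t.1.1 *m mxpow (Hmx d) t.1.2 *m mxpow (Emx d) t.2.
Definition pbw_ok (d : nat) (t : 'I_d.+1 * 'I_d.+1 * 'I_d.+1) : bool :=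
  (t.1.1 + t.1.2 + t.2 <= d)%N.

(* Main.v *)
(* Spanning: let P be the product killing h.  In any algebra satisfying the
   relations, e^c f^a p(h) = f^a p(h - 2c) e^c modulo terms f^a' q(h) e^c' with
   a' + c' < a + c.  Since P(h) = 0 and e^c P(h) f^a = 0, the ideal of those p
   for which f^a p(h) e^c reduces to such lower terms contains P(X) and
   P(X - 2(a + c)), hence their gcd, whose degree is d + 1 - a - c.  Euclidean
   division then leaves only the powers h^b with a + b + c <= d.
   Independence: the (S, S') entry of F^a H^b E^c on basis words, identified with
   the subsets where they take the value e_2, is a sum over T contained in the
   intersection of S and S'; downward induction on a + c isolates a polynomial
   identity in |T|.
   Universal property: applied to pairs (matrix, element of B), spanning gives
   a word and its image the same coefficients, and by independence these
   depend only on the matrix. *)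
Require Import Defs.
From HB Require Import structures.
From mathcomp Require Import all_boot all_order all_algebra.
From mathcomp Require Import zify ring.
Import Order.TTheory GRing.Theory Num.Theory.
Local Open Scope ring_scope.

Set Implicit Arguments.
Unset Strict Implicit.
Unset Printing Implicit Defensive.

(** * Linear spans as predicates *)

Inductive lspan (V : lmodType rat) (X : V -> Prop) : V -> Prop :=
| lspan0 : lspan X 0
| lspan_cons a x y : X x -> lspan X y -> lspan X (a *: x + y).

Section LinearSpan.
Variable V : lmodType rat.
Implicit Types X Y : V -> Prop.

Lemma lspanD X x y : lspan X x -> lspan X y -> lspan X (x + y).
Proof.
elim=> [|a u v Xu _ IH] Hy; first by rewrite add0r.
by rewrite -addrA; apply: lspan_cons => //; apply: IH.
Qed.

Lemma lspanZ X a x : lspan X x -> lspan X (a *: x).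
Proof.
elim=> [|b u v Xu _ IH]; first by rewrite scaler0; exact: lspan0.
by rewrite scalerDr scalerA; apply: lspan_cons.
Qed.

Lemma lspan_gen X x : X x -> lspan X x.
Proof.
by move=> Xx; rewrite -[x]scale1r -[_ *: _]addr0; apply: lspan_cons => //; exact: lspan0.
Qed.

Lemma lspan_sum X I (r : seq I) (P : pred I) (F : I -> V) :
  (forall i, P i -> lspan X (F i)) -> lspan X (\sum_(i <- r | P i) F i).
Proof.
move=> HF; apply: (big_ind (lspan X)) => //; first exact: lspan0.
exact: lspanD.
Qed.

Lemma lspan_trans X Y x : (forall z, X z -> lspan Y z) -> lspan X x -> lspan Y x.
Proof.
move=> H; elim=> [|a u v Xu _ IH]; first exact: lspan0.
by apply: lspanD => //; apply: lspanZ; apply: H.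
Qed.

Lemma lspan_seqP I (g : I -> V) x :
  lspan (fun z => exists i, z = g i) x <->
  exists s : seq (rat * I), x = \sum_(p <- s) p.1 *: g p.2.
Proof.
split=> [|[s ->]]; last first.
  by apply: lspan_sum => p _; apply: lspanZ; apply: lspan_gen; exists p.2.
elim=> [|a u v [i ->] _ [s ->]]; first by exists [::]; rewrite big_nil.
by exists ((a, i) :: s); rewrite big_cons.
Qed.

Lemma lspan_finP (I : finType) (P : pred I) (g : I -> V) x :
  lspan (fun z => exists2 i, P i & z = g i) x ->
  exists c : I -> rat, x = \sum_(i | P i) c i *: g i.
Proof.
elim=> [|a u v [i Pi ->] _ [c ->]].
  by exists (fun=> 0); rewrite big1 // => i _; rewrite scale0r.
exists (fun j => a *+ (j == i) + c j).
rewrite (eq_bigr _ (fun j _ => scalerDl _ _ _)) big_split /=.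
congr (_ + _); rewrite [RHS](bigD1 i) //= eqxx big1 ?addr0 // => j /andP [_ /negPf ->].
by rewrite scale0r.
Qed.

End LinearSpan.

Lemma lspan_linear (V W : lmodType rat) (f : V -> W) (X : V -> Prop) (Y : W -> Prop) x :
  linear f -> (forall z, X z -> lspan Y (f z)) -> lspan X x -> lspan Y (f x).
Proof.
move=> fL Hf; elim=> [|a u v Xu _ IH].
  by have:= fL (-1) 0 0; rewrite scaler0 addr0 scaleN1r addNr => ->; exact: lspan0.
by rewrite fL; apply: lspanD => //; apply: lspanZ; apply: Hf.
Qed.

(** * Straightening in an algebra satisfying the relations *)

Section Straightening.
Variables (B : algType rat) (e f h : B).
Hypothesis he : h * e - e * h = e *+ 2.
Hypothesis ef : e * f - f * e = h.
Hypothesis hf : h * f - f * h = - (f *+ 2).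

Local Notation ev := (horner_alg h).
Local Notation shift p c := (p \Po ('X - (c%:R)%:P)).

Lemma shift_shift (p : {poly rat}) m n : shift (shift p m) n = shift p (m + n).
Proof.
rewrite -comp_polyA comp_polyB comp_polyX comp_polyC natrD polyCD.
by congr (_ \Po _); ring.
Qed.

(** Moving [x] past one factor [h] replaces it by [q(h)]; since [ev] is multiplicative, moving [x]
    past [p(h)] composes [p] with [q]. *)
Lemma intertwine (x : B) (q : {poly rat}) : x * h = ev q * x ->
  forall p, x * ev p = ev (p \Po q) * x.
Proof.
move=> xh; elim/poly_ind=> [|p c IH]; first by rewrite comp_poly0 !rmorph0 mulr0 mul0r.
rewrite comp_polyD comp_polyM comp_polyX comp_polyC !rmorphD !rmorphM /=.
rewrite horner_algX !horner_algC mulrDr mulrDl mulrA IH -!mulrA xh !mulrA.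
by rewrite -scalerAl mul1r -scalerAr mulr1.
Qed.

Lemma intertwine_r (x : B) (q : {poly rat}) : h * x = x * ev q ->
  forall p, ev p * x = x * ev (p \Po q).
Proof.
move=> xh; elim/poly_ind=> [|p c IH]; first by rewrite comp_poly0 !rmorph0 mulr0 mul0r.
rewrite comp_polyD comp_polyM comp_polyX comp_polyC !rmorphD !rmorphM /=.
rewrite horner_algX !horner_algC mulrDr mulrDl -mulrA xh 2!mulrA IH -!mulrA.
by rewrite -scalerAl mul1r -scalerAr mulr1.
Qed.

Lemma ev_shift c : ev ('X - (c%:R)%:P) = h - c%:R.
Proof. by rewrite rmorphB /= horner_algX horner_algC scaler_nat. Qed.

Lemma e_ev p : e * ev p = ev (shift p 2) * e.
Proof.
apply: intertwine; rewrite ev_shift mulrBl mulr_natl -he.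
by rewrite opprB addrCA subrr addr0.
Qed.

Lemma ev_f p : ev p * f = f * ev (shift p 2).
Proof.
apply: intertwine_r; rewrite ev_shift mulrBr mulr_natr -hf.
by rewrite addrCA subrr addr0.
Qed.

Lemma ev_fX p a : ev p * f ^+ a = f ^+ a * ev (shift p (2 * a)).
Proof.
elim: a p => [|a IH] p; first by rewrite mul1r mulr1 muln0 subr0 comp_polyXr.
by rewrite exprS mulrA ev_f -!mulrA IH shift_shift mulnS.
Qed.

(* [e, f^a] = a f^(a-1) (h - a + 1), stated without subtraction on a. *)
Lemma e_fX a : e * f ^+ a.+1 =
  f ^+ a.+1 * e + f ^+ a * ev (a.+1%:R *: ('X - (a%:R)%:P)).
Proof.
have E1 : e * f = f * e + h by rewrite -ef addrCA subrr addr0.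
elim: a => [|a IH].
  by rewrite mul1r expr1 scale1r ev_shift subr0.
rewrite [in LHS]exprSr mulrA IH mulrDl -[f ^+ a.+1 * e * f]mulrA -[_ * ev _ * f]mulrA.
rewrite ev_f E1 mulrDr [_ * (f * e)]mulrA [_ * (f * ev _)]mulrA -!exprSr.
rewrite -addrA; congr (_ + _); rewrite -{1}[h]horner_algX -mulrDr -rmorphD /=.
rewrite comp_polyZ comp_polyB comp_polyX comp_polyC; congr (_ * ev _).
(* What remains is [(a+1)(X-a-2) + X = (a+2)(X-a-1)]. *)
rewrite -!mul_polyC -!natr1 !polyCD; ring.
Qed.

Definition mono a p c := f ^+ a * ev p * e ^+ c.
(** The degree in [h] is left free, because each commutator of [e] with a power of [f] brings in a
    further linear factor in [h]. *)
Definition low n (x : B) := exists a c p, (a + c < n)%N /\ x = mono a p c.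

Lemma monoD a p q c : mono a (p + q) c = mono a p c + mono a q c.
Proof. by rewrite /mono rmorphD mulrDr mulrDl. Qed.

Lemma mono_low a p c n : (a + c < n)%N -> lspan (low n) (mono a p c).
Proof. by move=> ac; apply: lspan_gen; exists a, c, p. Qed.

(** Passing [p(h)] shifts [p] by 2; passing [f ^+ a] costs a commutator with one [f] fewer and no
    new [e]. *)
Lemma e_mono a p c :
  lspan (low (a + c).+1) (e * mono a p c - mono a (shift p 2) c.+1).
Proof.
rewrite /mono; have -> : f ^+ a * ev (shift p 2) * e ^+ c.+1 = f ^+ a * e * ev p * e ^+ c.
  by rewrite -[f ^+ a * e * ev p]mulrA e_ev exprS !mulrA.
case: a => [|a]; first by rewrite !mul1r !mulrA subrr; exact: lspan0.
rewrite !mulrA e_fX !mulrDl addrAC subrr add0r -[_ * ev _ * ev p]mulrA -rmorphM.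
by apply: mono_low; lia.
Qed.

Lemma e_low n x : lspan (low n) x -> lspan (low n.+1) (e * x).
Proof.
apply: (lspan_linear (f := *%R e)) => [a u v|z [a [c [p [ac ->]]]]].
  by rewrite mulrDr scalerAr.
rewrite -[e * _](subrK (mono a (shift p 2) c.+1)); apply: lspanD.
  by apply: lspan_trans (e_mono a p c) => {}z [a' [c' [q [Hac' ->]]]]; apply: mono_low; lia.
by apply: mono_low; lia.
Qed.

(** Each new factor [e] shifts the leading polynomial by 2 and raises the bound on the lower terms
    by one. *)
Lemma eX_mono a p c :
  lspan (low (a + c)) (e ^+ c * (f ^+ a * ev p) - mono a (shift p (2 * c)) c).
Proof.
elim: c => [|c IH].
  by rewrite /mono !muln0 subr0 comp_polyXr mulr1 mul1r subrr; exact: lspan0.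
rewrite [e ^+ c.+1]exprS -[e * _ * _]mulrA addnS mulnSr -shift_shift.
have := lspanD (e_low IH) (e_mono a (shift p (2 * c)) c).
by rewrite mulrBr addrA subrK.
Qed.

Lemma h_mono a p c : h * mono a p c = mono a (shift 'X (2 * a) * p) c.
Proof. by rewrite /mono -{1}[h]horner_algX !mulrA ev_fX rmorphM !mulrA. Qed.

Lemma f_mono a p c : f * mono a p c = mono a.+1 p c.
Proof. by rewrite /mono !mulrA -exprS. Qed.

(** * Spanning by the bounded monomials *)

Section Spanning.
Variable d : nat.
Hypothesis hP : \prod_(i < d.+1) (h + ((d%:Z - (2 * i)%:Z)%:~R : rat)%:A) = 0.

(** The polynomial killing [h] is [wpoly 0 d.+1]. With an index interval as parameter, substituting
    [X - 2n] translates the interval, and common factors are read off from overlaps. *)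
Definition wpoly lo hi : {poly rat} :=
  \prod_(lo <= j < hi) ('X - ((2 * j)%:R - d%:R)%:P).

Lemma wpoly_cat lo mid hi : (lo <= mid)%N -> (mid <= hi)%N ->
  wpoly lo hi = wpoly lo mid * wpoly mid hi.
Proof. exact: big_cat_nat. Qed.

Lemma wpoly_shift lo hi n : shift (wpoly lo hi) (2 * n) = wpoly (lo + n) (hi + n).
Proof.
rewrite /wpoly rmorph_prod /= big_addn addnK.
apply: eq_bigr => j _; rewrite comp_polyB comp_polyX comp_polyC.
by rewrite mulnDr natrD !polyCB polyCD; ring.
Qed.

Lemma wpoly_coprime a b a' b' : (b <= a')%N -> coprimep (wpoly a b) (wpoly a' b').
Proof.
move=> ba; rewrite /wpoly big_nat_cond; apply: (big_ind (fun p => coprimep p _)).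
- exact: coprime1p.
- by move=> x y; rewrite coprimepMl => -> ->.
move=> i /andP [/andP [_ ib] _].
rewrite big_nat_cond; apply: (big_ind (coprimep _)).
- exact: coprimep1.
- by move=> x y; rewrite coprimepMr => -> ->.
move=> j /andP [/andP [aj _] _]; rewrite coprimep_XsubC root_XsubC.
by rewrite (can_eq (subrK _)) eqr_nat; lia.
Qed.

Lemma size_wpoly lo hi : size (wpoly lo hi) = (hi - lo).+1.
Proof. by rewrite /wpoly size_prod_XsubC size_iota. Qed.

Lemma ev_wpoly : ev (wpoly 0 d.+1) = 0.
Proof.
rewrite -hP /wpoly big_mkord rmorph_prod /=.
apply: eq_bigr => i _; rewrite rmorphB /= horner_algX horner_algC.
by rewrite -scaleNr opprB rmorphB /= -!pmulrn.
Qed.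

Definition bounded_mono (x : B) :=
  exists2 t : 'I_d.+1 * 'I_d.+1 * 'I_d.+1, pbw_ok t
    & x = f ^+ t.1.1 * h ^+ t.1.2 * e ^+ t.2.

Lemma lspan_poly X a c (p : {poly rat}) : (forall b, (b < size p)%N -> lspan X (mono a 'X^b c)) ->
  lspan X (mono a p c).
Proof.
move=> H; rewrite /mono -[p]coefK poly_def rmorph_sum /= mulr_sumr mulr_suml.
apply: lspan_sum => i _; rewrite linearZ /= mulr_algl -scalerAr -scalerAl.
by apply: lspanZ; apply: H.
Qed.

Lemma mono_bounded a p c : lspan bounded_mono (mono a p c).
Proof.
have [n] := ubnP (a + c); elim: n a p c => // n IHn a p c ac_n.
have low_ok x : lspan (low (a + c)) x -> lspan bounded_mono x.
  apply: lspan_trans => z [a' [c' [q [lt_ac ->]]]].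
  by apply: IHn; apply: leq_trans lt_ac _.
have V1 r : mono a (r * wpoly 0 d.+1) c = 0.
  by rewrite /mono rmorphM /= ev_wpoly mulr0 mulr0 mul0r.
have V2 r : lspan bounded_mono (mono a (r * shift (wpoly 0 d.+1) (2 * (a + c))) c).
  (* [r] is shifted by [-2c] in advance, to offset the shift by [2c] incurred in crossing
     [e ^+ c]. *)
  set r' := r \Po ('X + ((2 * c)%:R)%:P).
  have := eX_mono a (shift (wpoly 0 d.+1) (2 * a) * r') c.
  (* [f ^+ a] times the shifted polynomial in [h] equals [P(h) f ^+ a = 0], so [eX_mono] places its
     own leading term among the lower ones. *)
  rewrite rmorphM /= [f ^+ a * _]mulrA -ev_fX ev_wpoly mul0r mul0r mulr0 sub0r.
  move=> /low_ok /(lspanZ (-1)); rewrite scaleN1r opprK rmorphM /= shift_shift -mulnDr.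
  rewrite /r' -[(r \Po _) \Po _]comp_polyA comp_polyD comp_polyX comp_polyC subrK comp_polyXr.
  by rewrite mulrC.
(* The indices common to [[0, d+1)] and [[a+c, d+1+a+c)]; for [a + c > d] there are none and [Q] is
   1. *)
pose Q := wpoly (a + c) d.+1.
have [L [R [LRP LP RP]]] : exists L R : {poly rat}, [/\ coprimep L R,
    wpoly 0 d.+1 = L * Q & shift (wpoly 0 d.+1) (2 * (a + c)) = R * Q].
  rewrite wpoly_shift add0n.
  case: (leqP (a + c) d.+1) => Hac.
    exists (wpoly 0 (a + c)), (wpoly d.+1 (d.+1 + (a + c))); split.
    - exact: wpoly_coprime.
    - exact: wpoly_cat.
    - by rewrite mulrC; apply: wpoly_cat => //; apply: leq_addr.
  exists (wpoly 0 d.+1), (wpoly (a + c) (d.+1 + (a + c))); split.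
  - by apply: wpoly_coprime; exact: ltnW.
  - by rewrite /Q /wpoly [X in _ * X]big_geq ?mulr1 // ltnW.
  - by rewrite /Q /wpoly [X in _ * X]big_geq ?mulr1 // ltnW.
have VQ r : lspan bounded_mono (mono a (r * Q) c).
  have /Bezout_eq1_coprimepP [[u v] /= uv] := LRP.
  have -> : r * Q = (r * u) * wpoly 0 d.+1 + (r * v) * shift (wpoly 0 d.+1) (2 * (a + c)).
    by rewrite RP LP -[in LHS](mulr1 r) -uv; ring.
  by rewrite monoD V1 add0r.
rewrite (divp_eq p Q) monoD; apply: lspanD => //.
have Q0 : Q != 0 by rewrite -size_poly_gt0 size_wpoly.
have := ltn_modpN0 p Q0; rewrite size_wpoly => sz.
apply: lspan_poly => b b_sz; apply: lspan_gen.
(* For [a + c > d] the truncated bound forces a zero remainder, so no exponent [b] occurs. *)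
have {sz b_sz} abc : (a + b + c <= d)%N.
  by have := leq_ltn_trans b_sz sz; rewrite ltnS ltn_subRL; lia.
have [ad bd cd] : [/\ a < d.+1, b < d.+1 & c < d.+1]%N by split; lia.
exists (Ordinal ad, Ordinal bd, Ordinal cd); first by rewrite /pbw_ok /=; lia.
by rewrite /mono rmorphXn /= horner_algX.
Qed.

Definition gen (i : 'I_3) : B := if val i == 0%N then e else if val i == 1%N then f else h.

Lemma word_bounded (s : seq 'I_3) : lspan bounded_mono (\prod_(i <- s) gen i).
Proof.
(* Monomials with arbitrary exponents span a space stable under left multiplication by the
   generators; the exponents are bounded only afterwards. *)
pose M x := exists a p c, x = mono a p c.
suff: lspan M (\prod_(i <- s) gen i).
  by apply: lspan_trans => z [a [p [c ->]]]; exact: mono_bounded.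
elim: s => [|i s IH].
  rewrite big_nil; apply: lspan_gen; exists 0%N, 1, 0%N.
  by rewrite /mono rmorph1 !mulr1.
rewrite big_cons; apply: (lspan_linear (f := *%R (gen i))) IH => [k u v|z [a [p [c ->]]]].
  by rewrite mulrDr scalerAr.
rewrite /gen; case: eqP => _; last case: eqP => _.
- rewrite -[e * _](subrK (mono a (shift p 2) c.+1)); apply: lspanD.
    by apply: lspan_trans (e_mono a p c) => {}z [a' [c' [q [_ ->]]]];
       apply: lspan_gen; exists a', q, c'.
  by apply: lspan_gen; exists a, (shift p 2), c.+1.
- by rewrite f_mono; apply: lspan_gen; exists a.+1, p, c.
- by rewrite h_mono; apply: lspan_gen; eexists; eexists; eexists.
Qed.

End Spanning.
End Straightening.

(** * The representation on tensor space *)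

Lemma rho_linear d : linear (rho d).
Proof.
move=> a x y; apply/matrixP => i j; rewrite !mxE big_distrr -big_split /=.
by apply: eq_bigr => k _; case: ifP => _; rewrite ?mxE // mulr0 addr0.
Qed.

HB.instance Definition _ d := GRing.isLinear.Build rat _ _ _ (rho d) (@rho_linear d).

Lemma word_of_bij d : bijective (@word_of d).
Proof. by exists enum_rank; [exact: enum_valK | exact: enum_rankK]. Qed.

(** * Tensor products of matrices and the commutation relations *)

Section KroneckerProducts.
Variable d : nat.

(** The matrix of the tensor product of the [X l] in the basis of words. *)
Definition kron (X : 'I_d -> 'M[rat]_2) : 'M[rat]_(N d) :=
  \matrix_(i, j) \prod_l X l (word_of i l) (word_of j l).

(** Expanding a product over slots of sums over ['I_2] gives a sum over functions from slots to
    ['I_2]: these are the intermediate words. *)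
Lemma kron_mul X Y : kron X *m kron Y = kron (fun l => X l *m Y l).
Proof.
apply/matrixP => i j; rewrite !mxE.
under [RHS]eq_bigr do rewrite mxE.
rewrite bigA_distr_bigA (reindex _ (onW_bij _ (word_of_bij d))) /=.
by apply: eq_bigr => k _; rewrite !mxE -big_split.
Qed.

Lemma eq_kron X Y : X =1 Y -> kron X = kron Y.
Proof. by move=> XY; apply/matrixP => i j; rewrite !mxE; apply: eq_bigr => l _; rewrite XY. Qed.

Definition slot (k : 'I_d) (x : 'M[rat]_2) (l : 'I_d) : 'M[rat]_2 := if l == k then x else 1%:M.

Lemma rhoE x : rho d x = \sum_k kron (slot k x).
Proof.
apply/matrixP => i j; rewrite mxE summxE; apply: eq_bigr => k _.
rewrite mxE (bigD1 k) //= {1}/slot eqxx.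
have -> : \prod_(l < d | l != k) slot k x l (word_of i l) (word_of j l) =
          \prod_(l < d | l != k) (word_of i l == word_of j l)%:R.
  by apply: eq_bigr => l /negPf lk; rewrite /slot lk mxE.
case: forallP => [all_eq|/forallP]; first by
  rewrite big1 ?mulr1 // => l lk; have := all_eq l; rewrite lk /= => ->.
rewrite negb_forall => /existsP [l]; rewrite negb_imply => /andP [lk /negPf ne].
by rewrite (bigD1 l) //= ne mul0r mulr0.
Qed.

(** Matrices placed in different slots commute, so only the terms with both in the same slot
    survive. *)
Lemma rho_commutator x y :
  rho d x *m rho d y - rho d y *m rho d x = rho d (x *m y - y *m x).
Proof.
rewrite raddfB /= !rhoE !mulmx_suml.
under eq_bigr do rewrite mulmx_sumr.
under [X in _ - X]eq_bigr do rewrite mulmx_sumr.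
rewrite [X in _ - X]exchange_big /= -!sumrB; apply: eq_bigr => k _.
rewrite -sumrB (bigD1 k) //= big1 ?addr0 => [|l lk].
  rewrite !kron_mul; congr (_ - _); apply: eq_kron => l; rewrite /slot;
  by case: (l == k); rewrite ?mulmx1.
rewrite !kron_mul; apply/eqP; rewrite subr_eq0; apply/eqP; apply: eq_kron => m.
rewrite /slot; have [->|_] := eqVneq m k; last by rewrite mul1mx mulmx1.
by rewrite eq_sym (negPf lk) mul1mx mulmx1.
Qed.

Lemma HE_commutator : Hmx d *m Emx d - Emx d *m Hmx d = Emx d *+ 2.
Proof.
rewrite rho_commutator mulmxBl mulmxBr !mul_delta_mx_cond /= !subr0 !sub0r opprK.
by rewrite -mulr2n raddfMn.
Qed.

Lemma EF_commutator : Emx d *m Fmx d - Fmx d *m Emx d = Hmx d.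
Proof. by rewrite rho_commutator !mul_delta_mx_cond. Qed.

Lemma HF_commutator : Hmx d *m Fmx d - Fmx d *m Hmx d = - (Fmx d *+ 2).
Proof.
rewrite rho_commutator mulmxBl mulmxBr !mul_delta_mx_cond /= !subr0 !sub0r.
by rewrite -opprD -mulr2n raddfN raddfMn.
Qed.

End KroneckerProducts.

(** * Weights of [H] and entries of the powers of [E] *)

Section Weights.
Variable d : nat.

Definition ones (i : 'I_(N d)) : {set 'I_d} := [set k | word_of i k == 1].

Lemma I2_neq1 (x : 'I_2) : (x != 1) = (x == 0).
Proof. by case: x => [[|[|[]]]]. Qed.

Lemma ones_inj : injective ones.
Proof.
move=> i j /setP ij; apply: (bij_inj (word_of_bij d)); apply/ffunP => k.
have := ij k; rewrite !inE.
by case: (word_of i k) (word_of j k) => [[|[|[]]] // ?] [[|[|[]]] // ?] //= _; apply: val_inj.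
Qed.

Lemma ones_surj S : exists i, ones i = S.
Proof.
exists (enum_rank ([ffun k => (k \in S)%:R] : tword d)).
apply/setP => k; rewrite inE /word_of enum_rankK ffunE.
by case: (k \in S).
Qed.

Definition weight (i : 'I_(N d)) : rat := d%:R - (2 * #|ones i|)%:R.

(** On the diagonal each slot contributes 1 or -1; distinct words agreeing off slot [k] differ at
    [k], where [diag(1,-1)] has entry 0. *)
Lemma Hmx_diag : Hmx d = diag_mx (\row_i weight i).
Proof.
apply/matrixP => i j; rewrite !mxE; have [<-|ij] := eqVneq i j.
  have -> : weight i = \sum_(k < d) (1 - (2 * (word_of i k == 1))%:R).
    rewrite big_split /= sumr_const card_ord sumrN -natr_sum -big_distrr /=.
    congr (_ - (2 * _)%:R); rewrite -sum1_card [LHS]big_mkcond /=.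
    by apply: eq_bigr => k _; rewrite inE; case: eqP.
  apply: eq_bigr => k _; have -> : [forall l, (l != k) ==> (word_of i l == word_of i l)].
    by apply/forallP => l; rewrite eqxx implybT.
  rewrite !mxE !andbb; case: (word_of i k) => [[|[|[]]]] //= _.
apply: big1 => k _; case: ifP => // /forallP agree.
rewrite !mxE; case ik: (word_of i k == word_of j k).
  case/eqP: ij; apply: (bij_inj (word_of_bij d)); apply/ffunP => l.
  by have [->|lk] := eqVneq l k; [exact/eqP | have := agree l; rewrite lk => /eqP].
move: ik; case: (word_of i k) (word_of j k) => [[|[|[]]] // ?] [[|[|[]]] // ?] //= _.
Qed.

Lemma mxprod_diag n (r : seq nat) (v : nat -> 'rV[rat]_n) :
  mxprod [seq diag_mx (v i) | i <- r] = diag_mx (\row_j \prod_(i <- r) v i 0 j).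
Proof.
elim: r => [|i r IH] /=; last rewrite /mxprod /= in IH *.
  by apply/matrixP => i j; rewrite !mxE big_nil.
by rewrite IH mulmx_diag; congr diag_mx; apply/rowP => j; rewrite !mxE big_cons.
Qed.

Lemma Hmx_annihilated :
  mxprod [seq Hmx d + ((d%:Z - (2 * i)%:Z)%:~R : rat)%:M | i <- iota 0 d.+1] = 0.
Proof.
pose v k := \row_i (weight i + (d%:Z - (2 * k)%:Z)%:~R).
have -> : [seq Hmx d + ((d%:Z - (2 * i)%:Z)%:~R : rat)%:M | i <- iota 0 d.+1] =
          [seq diag_mx (v i) | i <- iota 0 d.+1].
  apply: eq_map => k; rewrite Hmx_diag -diag_const_mx -raddfD; congr diag_mx.
  by apply/rowP => j; rewrite !mxE.
rewrite mxprod_diag; apply/matrixP => i j; rewrite !mxE.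
have le_d : (#|ones i| <= d)%N by rewrite -[X in (_ <= X)%N]card_ord max_card.
(* The factor of index [d - #|ones i|] vanishes at [weight i]. *)
rewrite (big_rem (d - #|ones i|)%N) ?mem_iota ?add0n ?ltnS ?leq_subr //.
rewrite mxE /weight rmorphB /= -!pmulrn mulnBr natrB ?leq_mul2l // -[(2 * d)%N]/(d + (d + 0))%N.
rewrite addn0 natrD (_ : _ - _ + _ = 0) ?mul0r ?mul0rn //; ring.
Qed.

Lemma mxpow_Hmx k : mxpow (Hmx d) k = diag_mx (\row_i weight i ^+ k).
Proof.
elim: k => [|k IH]; first by apply/matrixP => i j; rewrite !mxE expr0.
rewrite /mxpow iterS -/(mxpow _ k) IH Hmx_diag mulmx_diag; congr diag_mx.
by apply/rowP => j; rewrite !mxE exprS.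
Qed.

Lemma Fmx_tr : Fmx d = (Emx d)^T.
Proof.
apply/matrixP => i j; rewrite !mxE; apply: eq_bigr => k _.
under eq_forallb => l do rewrite (eq_sym (word_of i l)).
by case: ifP => // _; rewrite !mxE andbC.
Qed.

Lemma mxpowSr n (A : 'M[rat]_n) k : mxpow A k.+1 = mxpow A k *m A.
Proof.
elim: k => [|k IH]; first by rewrite /mxpow /= mul1mx mulmx1.
by rewrite [LHS]/mxpow iterS -/(mxpow A k.+1) {1}IH mulmxA.
Qed.

Lemma mxpow_tr n (A : 'M[rat]_n) k : mxpow A^T k = (mxpow A k)^T.
Proof.
elim: k => [|k IH]; first by rewrite /mxpow /= trmx1.
by rewrite mxpowSr trmx_mul -IH.
Qed.

(** Nonnegativity excludes cancellation, so one nonzero path makes an entry of a power of [E]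
    positive. *)
Lemma Emx_ge0 i j : 0 <= Emx d i j.
Proof.
rewrite mxE; apply: sumr_ge0 => k _; case: ifP => // _.
by rewrite mxE ler0n.
Qed.

Lemma Emx_neq0 i j : Emx d i j != 0 -> exists2 k, k \in ones j & ones i = ones j :\ k.
Proof.
rewrite mxE => H.
have [k _] : exists2 k, k \in 'I_d &
    (if [forall l : 'I_d, (l != k) ==> (word_of i l == word_of j l)]
      then (delta_mx 0 1 : 'M[rat]_2) (word_of i k) (word_of j k) else 0) != 0.
  by apply/exists_inP; apply: contraNT H => /exists_inPn H; apply/eqP; apply: big1 => k _;
     apply/eqP; rewrite -[_ == _]negbK; apply: H.
case: ifP => [/forallP agree|_]; last by rewrite eqxx.
rewrite mxE pnatr_eq0 eqb0 negbK => /andP [/eqP ik /eqP jk].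
exists k; first by rewrite inE jk.
apply/setP => l; rewrite !inE; have [->|lk] := eqVneq l k; first by rewrite ik.
by have := agree l; rewrite lk => /eqP ->.
Qed.

Lemma Emx_gt0 i j k : k \in ones j -> ones i = ones j :\ k -> 0 < Emx d i j.
Proof.
rewrite inE => /eqP jk /setP ij.
have agree l : l != k -> word_of i l = word_of j l.
  move=> lk; have := ij l; rewrite !inE lk /=.
  by case: (word_of i l) (word_of j l) => [[|[|[]]] // ?] [[|[|[]]] // ?] //= _; apply: val_inj.
have ik : word_of i k = 0 by apply/eqP; rewrite -I2_neq1; have := ij k; rewrite !inE eqxx /= => ->.
rewrite mxE (bigD1 k) //=; apply: ltr_wpDr.
  by apply: sumr_ge0 => l _; case: ifP => // _; rewrite mxE ler0n.
rewrite ifT; last by apply/forallP => l; apply/implyP => /agree ->.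
by rewrite ik jk mxE !eqxx.
Qed.

Lemma mxpow_Emx_ge0 c i j : 0 <= mxpow (Emx d) c i j.
Proof.
elim: c i j => [|c IH] i j; first by rewrite mxE ler0n.
by rewrite /mxpow iterS mxE; apply: sumr_ge0 => k _; apply: mulr_ge0; [exact: Emx_ge0 | exact: IH].
Qed.

Lemma mxpow_Emx_neq0 c i j : mxpow (Emx d) c i j != 0 ->
  ones i \subset ones j /\ #|ones j| = (#|ones i| + c)%N.
Proof.
elim: c i => [|c IH] i; first by rewrite mxE pnatr_eq0 eqb0 negbK => /eqP ->; rewrite addn0.
rewrite /mxpow iterS -/(mxpow _ c) mxE => H.
have [k Hk] : exists k, Emx d i k * mxpow (Emx d) c k j != 0.
  by apply/existsP; apply: contraNT H => /existsPn H; apply/eqP; apply: big1 => k _;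
     apply/eqP; rewrite -[_ == _]negbK; apply: H.
move: Hk; rewrite mulf_eq0 negb_or => /andP [/Emx_neq0 [l lk ->] /IH [sub card]].
split; first by apply: subset_trans sub; rewrite subD1set.
by rewrite card (cardsD1 l (ones k)) lk add1n addSnnS.
Qed.

Lemma mxpow_Emx_gt0 c i j : ones i \subset ones j -> #|ones j| = (#|ones i| + c)%N ->
  0 < mxpow (Emx d) c i j.
Proof.
elim: c i => [|c IH] i sub card.
  have /ones_inj -> : ones i = ones j by apply/eqP; rewrite eqEcard sub card addn0 leqnn.
  by rewrite mxE eqxx.
(* The path goes through the word whose set is [ones i] with one position of [ones j] added. *)
have [k] : exists k, k \in ones j :\: ones i.
  apply/set0Pn; rewrite -card_gt0 cardsD (setIidPr sub) card; lia.
rewrite inE => /andP [ki kj]; have [m om] := ones_surj (k |: ones i).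
rewrite /mxpow iterS mxE (bigD1 m) //=; apply: ltr_wpDr.
  by apply: sumr_ge0 => l _; apply: mulr_ge0; [exact: Emx_ge0 | exact: mxpow_Emx_ge0].
apply: mulr_gt0; last apply: IH.
- by apply: (Emx_gt0 (k := k)); rewrite om ?setU11 // setU1K.
- by rewrite om subUset sub1set kj sub.
- by rewrite om cardsU1 ki card addnS.
Qed.

End Weights.

(** * Linear independence of the monomials *)

Lemma card_ord_interval d lo hi : (hi <= d)%N ->
  #|[set k : 'I_d | lo <= k < hi]%N| = (hi - lo)%N.
Proof.
move=> hid; rewrite -sum1_card; under eq_bigl do rewrite inE.
rewrite -(big_mkord (fun k => lo <= k < hi)%N (fun=> 1%N)).
by rewrite -[RHS]muln1 -sum_nat_const_nat [RHS](big_nat_widenl _ 0) //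
           [RHS](big_nat_widen _ _ d).
Qed.

(** The intervals [[0,u+a)] and [[a,u+a+c)] meet in [[a,u+a)]. They select a matrix entry at which
    [H] is seen with weight [d - 2u]. *)
Lemma overlapping_sets d a c u : (a + c + u <= d)%N ->
  exists S S' : {set 'I_d}, [/\ #|S| = (u + a)%N, #|S'| = (u + c)%N & #|S :&: S'| = u].
Proof.
move=> acu; exists ([set k : 'I_d | 0 <= k < u + a]%N), ([set k : 'I_d | a <= k < u + a + c]%N).
split; rewrite ?card_ord_interval; try lia.
have -> : [set k : 'I_d | 0 <= k < u + a]%N :&: [set k : 'I_d | a <= k < u + a + c]%N =
   [set k : 'I_d | a <= k < u + a]%N.
  by apply/setP => k; rewrite !inE; lia.
by rewrite card_ord_interval; lia.
Qed.

Section Independence.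
Variable d : nat.
Local Notation T := ('I_d.+1 * 'I_d.+1 * 'I_d.+1)%type.

Lemma pbwE (t : T) i j : pbw t i j =
  \sum_m mxpow (Emx d) t.1.1 m i * weight m ^+ t.1.2 * mxpow (Emx d) t.2 m j.
Proof.
rewrite /pbw Fmx_tr mxpow_tr mxpow_Hmx mul_mx_diag mxE.
by apply: eq_bigr => m _; rewrite !mxE.
Qed.

Lemma pbw_independent (c : T -> rat) :
  \sum_(t | pbw_ok t) c t *: pbw t = 0 -> forall t, pbw_ok t -> c t = 0.
Proof.
move=> sum0 t0; have [n] := ubnP (d - (t0.1.1 + t0.2)).
(* From here [e] is the exponent of [Emx d]. Measuring by [d - (a + e)] makes the induction run
   downwards on [a + e]. *)
elim: n t0 => // n IHn [[a b] e] /= t0_n ok0.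
pose Q (t : T) := [&& pbw_ok t, t.1.1 == a & t.2 == e].
(* The coefficients with [a] and [e] fixed form one polynomial, evaluated below at the weights of
   [H]. *)
pose g : {poly rat} := \sum_(t | Q t) c t *: 'X^(t.1.2).
have g_coef : g`_b = c (a, b, e).
  rewrite coef_sum (bigD1 (a, b, e)) /=; last by rewrite /Q ok0 !eqxx.
  rewrite coefZ coefXn eqxx mulr1 big1 ?addr0 // => t /andP [/and3P [_ /eqP ta /eqP te] tt0].
  rewrite coefZ coefXn; case: eqP => [tb|_]; last by rewrite mulr0.
  by case/eqP: tt0; case: t ta tb te => [[? ?] ?] /= -> /ord_inj -> ->.
have g_root u : (a + e + u <= d)%N -> root g (d%:R - (2 * u)%:R).
  move=> aeu; have [S [S' [cS cS' cSS']]] := overlapping_sets aeu.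
  have [i Ei] := ones_surj S; have [j Ej] := ones_surj S'; have [m Em] := ones_surj (S :&: S').
  have K_gt0 : 0 < mxpow (Emx d) a m i * mxpow (Emx d) e m j.
    by apply: mulr_gt0; apply: mxpow_Emx_gt0;
       rewrite ?Em ?Ei ?Ej ?subsetIl ?subsetIr ?cSS' ?cS ?cS'.
  have := congr1 (fun M : 'M_(N d) => M i j) sum0; rewrite summxE mxE /= => entry0.
  rewrite /root horner_sum -(mulrI_eq0 _ (mulfI (lt0r_neq0 K_gt0))) mulr_sumr -[X in _ == X]entry0.
  apply/eqP; rewrite big_mkcond [RHS]big_mkcond; apply: eq_bigr => -[[a' b'] e'] _.
  rewrite /Q /=; case: ifP => [/and3P [-> /eqP -> /eqP ->]|notQ].
    rewrite hornerZ hornerXn mxE pbwE (bigD1 m) //= big1 ?addr0.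
      by rewrite /weight Em cSS'; ring.
    (* A contributing [m'] has [u] ones, all in [S :&: S'], which has only [u] elements; so it is
       [m]. *)
    move=> m' m'm; apply/eqP; apply: contraR m'm; rewrite !mulf_eq0 !negb_or.
    move=> /andP [/andP [/mxpow_Emx_neq0 [si ci] _] /mxpow_Emx_neq0 [sj cj]].
    apply/eqP/ones_inj/eqP; rewrite eqEcard Em subsetI -{1}Ei si -{1}Ej sj cSS' /=.
    by move: ci; rewrite Ei cS => /addIn <-.
  case: ifP => // ok; rewrite mxE; apply/eqP; rewrite eq_sym mulf_eq0.
  (* A larger [a' + e'] has zero coefficient by induction; otherwise the entry of the monomial is
     zero. *)
  apply/orP; case: (ltnP (a + e) (a' + e')) => [lt_t|le_t].
    by left; apply/eqP; apply: IHn => //; move: ok lt_t t0_n; rewrite /pbw_ok /=; lia.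
  right; rewrite pbwE; apply/eqP; apply: big1 => m' _; apply/eqP.
  apply/negPn; apply/negP; rewrite !mulf_eq0 !negb_or.
  move=> /andP [/andP [/mxpow_Emx_neq0 [si ci] _] /mxpow_Emx_neq0 [sj cj]].
  have le_u : (#|ones m'| <= u)%N.
    by rewrite -cSS'; apply: subset_leq_card; rewrite subsetI -Ei si -Ej sj.
  move: ci cj; rewrite Ei Ej cS cS' /= => ci cj.
  (* An intermediate word has at most [u] ones, so [a' >= a] and [e' >= e]; as the sum is not
     larger, equality holds, against [notQ]. *)
  have tight k x y x' y' : (k <= u -> u + x = k + x' -> u + y = k + y' ->
    x' + y' <= x + y -> x' = x /\ y' = y)%N by lia.
  have [ta te] := tight _ _ _ _ _ le_u ci cj le_t.
  by move: notQ; rewrite ok -!val_eqE /= ta te !eqxx.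
have size_g : (size g <= (d - (a + e)).+1)%N.
  apply: (leq_trans (size_sum _ _ _)).
  apply/bigmax_leqP => -[[a' b'] e'] /and3P [ok /= /eqP ta /eqP te].
  apply: (leq_trans (size_scale_leq _ _)); rewrite size_polyXn.
  by move: ok; rewrite /pbw_ok /= ta te; lia.
suff g0 : g = 0 by rewrite -g_coef g0 coef0.
(* [g] has one root more than its degree bound [d - (a + e)]. *)
apply: (@roots_geq_poly_eq0 _ g [seq d%:R - (2 * u)%:R : rat | u <- iota 0 (d - (a + e)).+1]).
- by apply/allP => x /mapP [u]; rewrite mem_iota => uI ->; apply: g_root;
     move: ok0 uI; rewrite /pbw_ok /=; lia.
- rewrite map_inj_uniq ?iota_uniq // => u v /(addrI _) /oppr_inj /eqP.
  by rewrite eqr_nat => /eqP; lia.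
- by rewrite size_map size_iota.
Qed.

End Independence.

(** The coordinate forms of a free family are linear on all of [V], so no complement of its span has
    to be chosen. *)
Lemma linear_extension (V : vectType rat) (W : lmodType rat) (I : finType) (P : pred I)
    (g : I -> V) (m : I -> W) :
  (forall c : I -> rat, \sum_(i | P i) c i *: g i = 0 -> forall i, P i -> c i = 0) ->
  exists phi : {linear V -> W}, forall i, P i -> phi (g i) = m i.
Proof.
move=> indep; pose X := [tuple g (enum_val i) | i < #|P|].
have freeX : free X.
  apply/freeP => k k0 i; have Pi := enum_valP i.
  rewrite -(enum_valK_in Pi i).
  apply: (indep (fun t => k (enum_rank_in Pi t))) => //.
  rewrite big_enum_val /= -[RHS]k0; apply: eq_bigr => j _.
  by rewrite enum_valK_in -tnth_nth tnth_mktuple.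
pose phi0 (x : V) : W := \sum_(i < #|P|) coord X i x *: m (enum_val i).
have phi0_lin : linear phi0.
  move=> a x y; rewrite /phi0 scaler_sumr -big_split; apply: eq_bigr => i _ /=.
  by rewrite linearP scalerDl scalerA.
pose phi : {linear V -> W} := HB.pack phi0 (GRing.isLinear.Build _ _ _ _ phi0 phi0_lin).
exists phi => i Pi; rewrite /= /phi0 (bigD1 (enum_rank_in Pi i)) //=.
have -> : g i = X`_(enum_rank_in Pi i).
  by rewrite -tnth_nth tnth_mktuple enum_rankK_in.
rewrite coord_free // eqxx scale1r enum_rankK_in // big1 ?addr0 // => j /negPf ji.
by rewrite coord_free // eq_sym ji scale0r.
Qed.

(** * Comparison with an arbitrary algebra satisfying the relations *)

Section Transfer.
Variable d : nat.
Local Notation T := ('I_d.+1 * 'I_d.+1 * 'I_d.+1)%type.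

Lemma mxprodE n (s : seq 'M[rat]_n.+1) : mxprod s = \prod_(x <- s) x.
Proof. by elim: s => [|x s IH]; rewrite ?big_nil ?big_cons //= -IH. Qed.

Lemma mxpowE n (A : 'M[rat]_n.+1) k : mxpow A k = A ^+ k.
Proof. by elim: k => // k IH; rewrite /mxpow iterS exprS -IH. Qed.

Lemma sl2d_rels_mxE n (e f h : 'M[rat]_n.+1) : sl2d_rels_mx d e f h -> sl2d_rels d e f h.
Proof.
case=> he ef hf hP; split=> //; rewrite -[RHS]hP mxprodE big_map.
rewrite -(big_mkord xpredT (fun i => h + ((d%:Z - (2 * i)%:Z)%:~R : rat)%:A)).
rewrite /index_iota subn0.
by apply: eq_bigr => i _; rewrite -scalemx1.
Qed.

(** Straightening in the product algebra and projecting gives the same coefficients in both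
    factors. *)
Lemma sl2d_rels_pair (A B : algType rat) (e f h : A) (e' f' h' : B) :
  sl2d_rels d e f h -> sl2d_rels d e' f' h' ->
  sl2d_rels d ((e, e') : A * B) (f, f') (h, h').
Proof.
case=> he ef hf hP [he' ef' hf' hP'].
have eq_pair (x y : A * B) : x.1 = y.1 -> x.2 = y.2 -> x = y.
  by case: x y => [? ?] [? ?] /= -> ->.
split; apply: eq_pair; rewrite ?mulr2n //= -?mulr2n //.
- by rewrite rmorph_prod.
- by rewrite rmorph_prod.
Qed.

Definition mx_mono n (e f h : 'M[rat]_n) (t : T) :=
  mxpow f t.1.1 *m mxpow h t.1.2 *m mxpow e t.2.

Lemma mx_word_bounded n (e f h : 'M[rat]_n) (s : seq 'I_3) : (0 < n)%N ->
  sl2d_rels_mx d e f h ->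
  exists c : T -> rat,
    mxprod [seq gen3 e f h i | i <- s] = \sum_(t | pbw_ok t) c t *: mx_mono e f h t.
Proof.
case: n e f h => // n e f h _ /sl2d_rels_mxE [he ef hf hP].
rewrite mxprodE big_map; have /lspan_finP [c Ec] := word_bounded he ef hf hP s.
by exists c; rewrite [LHS]Ec; apply: eq_bigr => t _; rewrite /mx_mono !mxpowE.
Qed.

Lemma mx_word_transfer n (e f h : 'M[rat]_n) (B : algType rat) (e' f' h' : B) (s : seq 'I_3) :
  (0 < n)%N -> sl2d_rels_mx d e f h -> sl2d_rels d e' f' h' ->
  exists c : T -> rat,
    mxprod [seq gen3 e f h i | i <- s] = \sum_(t | pbw_ok t) c t *: mx_mono e f h t /\
    \prod_(i <- s) gen e' f' h' i =
      \sum_(t | pbw_ok t) c t *: (f' ^+ t.1.1 * h' ^+ t.1.2 * e' ^+ t.2).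
Proof.
case: n e f h => // n e f h _ /sl2d_rels_mxE rels rels'.
have [he ef hf hP] := sl2d_rels_pair rels rels'.
have /lspan_finP [c Ec] := word_bounded he ef hf hP s.
have pairX (A1 A2 : algType rat) (x : A1) (y : A2) k : ((x, y) : A1 * A2) ^+ k = (x ^+ k, y ^+ k).
  by elim: k => // k IH; rewrite !exprS IH.
exists c; split.
  rewrite mxprodE big_map; have := congr1 fst Ec; rewrite rmorph_prod raddf_sum /= => Ec1.
  transitivity (\prod_(i <- s) (gen (e, e') (f, f') (h, h') i).1).
    by apply: eq_bigr => i _; rewrite /gen3 /gen; do 2?case: ifP.
  by rewrite Ec1; apply: eq_bigr => t _; rewrite /mx_mono !mxpowE !pairX.
have := congr1 snd Ec; rewrite rmorph_prod raddf_sum /= => Ec2.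
transitivity (\prod_(i <- s) (gen (e, e') (f, f') (h, h') i).2).
  by apply: eq_bigr => i _; rewrite /gen; do 2?case: ifP.
by rewrite Ec2; apply: eq_bigr => t _; rewrite !pairX.
Qed.

End Transfer.

(** * Generation of the Schur algebra by [E], [F] and [H] *)

Section Generation.
Variable d : nat.

Definition rho_word (l : seq 'M[rat]_2) : 'M[rat]_(N d) := mxprod [seq rho d x | x <- l].
Definition gen_word (w : seq 'I_3) := mxprod [seq gen3 (Emx d) (Fmx d) (Hmx d) i | i <- w].

Lemma in_schurP A : in_schur A <-> lspan (fun z => exists l, z = rho_word l) A.
Proof. by split=> [[s Es]|/lspan_seqP //]; apply/lspan_seqP; exists s. Qed.

Lemma in_span_wordsP A : in_span_words (Emx d) (Fmx d) (Hmx d) A <->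
  lspan (fun z => exists w, z = gen_word w) A.
Proof. by split=> [[s Es]|/lspan_seqP //]; apply/lspan_seqP; exists s. Qed.

Lemma gen_wordE w : exists l, gen_word w = rho_word l.
Proof.
exists [seq gen3 (delta_mx 0 1) (delta_mx 1 0) (delta_mx 0 0 - delta_mx 1 1) i | i <- w].
rewrite /rho_word -map_comp; congr mxprod; apply: eq_map => i.
by rewrite /= /gen3; do 2?case: ifP.
Qed.

(** The centre of [gl_2] acts by scalars, so [E], [F], [H] generate the algebra together with 1. *)
Lemma rho1 : rho d 1%:M = d%:R%:M.
Proof.
have kron1 : kron (fun=> 1%:M) = 1%:M :> 'M_(N d).
  apply/matrixP => i j; rewrite !mxE; have [->|ij] := eqVneq i j.
    by rewrite big1 // => l _; rewrite mxE eqxx.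
  have [l ne] : exists l, word_of i l != word_of j l.
    apply/existsP; apply: contraNT ij => /existsPn eq_ij.
    apply/eqP/(bij_inj (word_of_bij d))/ffunP => l.
    by have := eq_ij l; rewrite negbK => /eqP.
  by rewrite (bigD1 l) //= mxE (negPf ne) mul0r.
rewrite rhoE; under eq_bigr => k _.
  rewrite (@eq_kron _ _ (fun=> 1%:M)) ?kron1; last by move=> l; rewrite /slot if_same.
  over.
by rewrite sumr_const card_ord -scaler_nat scalemx1.
Qed.

Lemma rho_decomposition x : rho d x =
  x 0 1 *: Emx d + x 1 0 *: Fmx d + ((x 0 0 - x 1 1) / 2) *: Hmx d
    + ((x 0 0 + x 1 1) / 2 * d%:R)%:M.
Proof.
(* With the scalar rewritten through [rho1], linearity of [rho] leaves an identity between 2 by 2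
   matrices. *)
rewrite -scalemx1 -[(_ * d%:R) *: _]scalerA scalemx1 -rho1 -!linearZ -!linearD; congr rho.
apply/matrixP => i j; rewrite !mxE.
case: i j => [[|[|[]]] // ?] [[|[|[]]] // ?] /=;
  rewrite ?(mulr0, mulr1, addr0, add0r, subr0, sub0r).
- rewrite (_ : Ordinal _ = 0); last exact: val_inj.
  by rewrite (_ : Ordinal _ = 0); [field | exact: val_inj].
- by congr (x _ _); apply: val_inj.
- by congr (x _ _); apply: val_inj.
- rewrite (_ : Ordinal _ = 1); last exact: val_inj.
  by rewrite (_ : Ordinal _ = 1); [field | exact: val_inj].
Qed.

Lemma rho_word_gen l : lspan (fun z => exists w, z = gen_word w) (rho_word l).
Proof.
elim: l => [|x l IH]; first by apply: lspan_gen; exists [::].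
rewrite /rho_word /= -/(rho_word l) rho_decomposition.
have mul_gen i : lspan (fun z => exists w, z = gen_word w)
    (gen3 (Emx d) (Fmx d) (Hmx d) i *m rho_word l).
  apply: (lspan_linear (f := mulmx _)) IH => [a u v|z [w ->]].
    by rewrite mulmxDr scalemxAr.
  by apply: lspan_gen; exists (i :: w).
rewrite !mulmxDl -!scalemxAl mul_scalar_mx; do 3?apply: lspanD; apply: lspanZ => //.
- exact: (mul_gen 0).
- exact: (mul_gen 1).
- by have := mul_gen (inord 2); rewrite /gen3 /= inordK.
Qed.

Lemma in_schur_span A : in_schur A <-> lspan (fun z => exists w, z = gen_word w) A.
Proof.
rewrite in_schurP; split; apply: lspan_trans => z [l ->]; first exact: rho_word_gen.
by have [l' ->] := gen_wordE l; apply: lspan_gen; exists l'.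
Qed.

Lemma gen_word_cat w w' : gen_word (w ++ w') = gen_word w *m gen_word w'.
Proof.
rewrite /gen_word; elim: w => [|i w IH] /=; first by rewrite mul1mx.
by rewrite -mulmxA -IH.
Qed.

End Generation.

Theorem theorem2p1 (d : nat) :
  (* (1) S(2,d) is a presentation of the algebra <e,f,h | relations>:
         the generators e, f, h are realised by Emx, Fmx, Hmx ... *)
  ([/\ in_schur (Emx d), in_schur (Fmx d) & in_schur (Hmx d)] /\
      (* ... which satisfy the relations, *)
      sl2d_rels_mx d (Emx d) (Fmx d) (Hmx d) /\
      (* ... which generate S(2,d) as a unital Q-algebra, *)
      (forall A : 'M[rat]_(N d), in_schur A <-> in_span_words (Emx d) (Fmx d) (Hmx d) A) /\
      (* ... and universal property: any triple satisfying the relations in any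
             associative unital Q-algebra B is the image of (E,F,H) under a unital
             Q-algebra homomorphism S(2,d) -> B (restriction of a linear map) *)
      (forall (B : algType rat) (e f h : B), sl2d_rels d e f h ->
         exists phi : {linear 'M[rat]_(N d) -> B},
           [/\ phi 1%:M = 1,
               (forall x y, in_schur x -> in_schur y -> phi (x *m y) = phi x * phi y),
               phi (Emx d) = e, phi (Fmx d) = f & phi (Hmx d) = h]) /\
  (* (2) the monomials f^a h^b e^c, a+b+c <= d, form a Q-basis *)
      (forall c : 'I_d.+1 * 'I_d.+1 * 'I_d.+1 -> rat,
         \sum_(t | pbw_ok t) c t *: pbw t = 0 -> forall t, pbw_ok t -> c t = 0)
   /\ (forall A : 'M[rat]_(N d), in_schur A ->
         exists c : 'I_d.+1 * 'I_d.+1 * 'I_d.+1 -> rat,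
           A = \sum_(t | pbw_ok t) c t *: pbw t)).
Proof.
have rels : sl2d_rels_mx d (Emx d) (Fmx d) (Hmx d).
  split; [exact: HE_commutator | exact: EF_commutator | exact: HF_commutator |].
  exact: Hmx_annihilated.
have N_gt0 : (0 < N d)%N by rewrite /N card_ffun !card_ord expn_gt0.
have wordE : gen_word d [:: 0] = Emx d by exact: mulmx1.
have wordF : gen_word d [:: 1] = Fmx d by exact: mulmx1.
have wordH : gen_word d [:: inord 2] = Hmx d.
  by rewrite /gen_word /gen3 /= inordK //=; exact: mulmx1.
have schur_word w : in_schur (gen_word d w).
  by apply/in_schur_span; apply: lspan_gen; exists w.
split; first by rewrite -wordE -wordF -wordH; split; exact: schur_word.
split=> //.
split; first by move=> A; rewrite in_schur_span in_span_wordsP.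
split; last split; first last.
- move=> A /in_schur_span span_A; apply: lspan_finP; apply: lspan_trans span_A => z [w ->].
  have [c Ew] := mx_word_bounded w N_gt0 rels; rewrite [gen_word d w]Ew.
  by apply: lspan_sum => t ok; apply: lspanZ; apply: lspan_gen; exists t.
- exact: pbw_independent.
move=> B e f h relsB.
(* [phi] is prescribed on the independent monomials only; the coefficients shared by a word and its
   image then determine it on words. *)
have [phi phi_pbw] := linear_extension
  (fun t : 'I_d.+1 * 'I_d.+1 * 'I_d.+1 => f ^+ t.1.1 * h ^+ t.1.2 * e ^+ t.2)
  (@pbw_independent d).
have phi_word w : phi (gen_word d w) = \prod_(i <- w) gen e f h i.
  have [c [Ew ->]] := mx_word_transfer w N_gt0 rels relsB.
  rewrite [gen_word d w]Ew linear_sum; apply: eq_bigr => t ok.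
  by rewrite linearZ; congr (_ *: _); apply: phi_pbw.
exists phi; split.
- by have := phi_word [::]; rewrite big_nil.
- move=> x y /in_schur_span x_span /in_schur_span y_span.
  (* Bilinearity reduces multiplicativity to two words, whose product is the concatenated word. *)
  elim: x_span => [|a _ x' [w ->] _ IH]; first by rewrite mul0mx !linear0 mul0r.
  rewrite mulmxDl !linearD mulrDl IH -scalemxAl !linearZ -scalerAl; congr (_ *: _ + _).
  elim: y_span {IH} => [|b _ y' [w' ->] _ IH]; first by rewrite mulmx0 !linear0 mulr0.
  rewrite mulmxDr !linearD mulrDr IH -scalemxAr !linearZ -scalerAr; congr (_ *: _ + _).
  by rewrite -gen_word_cat !phi_word big_cat.
- by rewrite -wordE phi_word big_seq1.
- by rewrite -wordF phi_word big_seq1.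
- by rewrite -wordH phi_word big_seq1 /gen /= inordK.
Qed.
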